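(* For all integers $n,k\ge 1$ and $s\ge 1$, the Lah numbers of order $s$ satisfy the recurrence $$\left\lceil\!\!\left\lceil\begin{matrix} n\\ k\end{matrix}\right\rceil\!\!\right\rceil_{s}=\left\lceil\!\!\left\lceil\begin{matrix} n-1\\ k-1\end{matrix}\right\rceil\!\!\right\rceil_{s}+\left((n-1)^s+k^s\right)\left\lceil\!\!\left\lceil\begin{matrix} n-1\\ k\end{matrix}\right\rceil\!\!\right\rceil_{s},$$ with boundary conditions $$\left\lceil\!\!\left\lceil\begin{matrix} n\\ n\end{matrix}\right\rceil\!\!\right\rceil_{s}=1\ \text{ for } n\ge 0,\qquad \left\lceil\!\!\left\lceil\begin{matrix} n\\ 0\end{matrix}\right\rceil\!\!\right\rceil_{s}=\left\lceil\!\!\left\lceil\begin{matrix} 0\\ n\end{matrix}\right\rceil\!\!\right\rceil_{s}=0\ \text{ for } n>0.$$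
   Context: For a partition $\pi=\{b_1,\dots,b_k\}$ of $[n]=\{1,\dots,n\}$ into non-empty blocks, $\operatorname{bl}\pi=\{\min b_1,\dots,\min b_k\}$. For $s\ge1$, the Stirling number of the first kind with higher level, $\left[\!\left[\begin{matrix} n\\ k\end{matrix}\right]\!\right]_{s}$ (resp. of the second kind, $\left\{\!\left\{\begin{matrix} n\\ k\end{matrix}\right\}\!\right\}_{s}$), is the number of ordered $s$-tuples $(\pi_1,\dots,\pi_s)$ of partitions of $[n]$ into $k$ non-empty cyclically ordered blocks (resp. $k$ non-empty unordered blocks) with $\operatorname{bl}\pi_1=\dots=\operatorname{bl}\pi_s$. Equivalently (known), they are determined for $n,k\ge1$ by $\left[\!\left[\begin{matrix} n\\ k\end{matrix}\right]\!\right]_{s}=\left[\!\left[\begin{matrix} n-1\\ k-1\end{matrix}\right]\!\right]_{s}+(n-1)^s\left[\!\left[\begin{matrix} n-1\\ k\end{matrix}\right]\!\right]_{s}$ and $\left\{\!\left\{\begin{matrix} n\\ k\end{matrix}\right\}\!\right\}_{s}=\left\{\!\left\{\begin{matrix} n-1\\ k-1\end{matrix}\right\}\!\right\}_{s}+k^s\left\{\!\left\{\begin{matrix} n-1\\ k\end{matrix}\right\}\!\right\}_{s}$, both being $1$ at $(n,k)=(0,0)$ and $0$ at $(n,0)$ and $(0,n)$ for $n>0$. The Lah numbers of order $s$ are defined for integers $n,k\ge0$, $s\ge1$ by $$\left\lceil\!\!\left\lceil\begin{matrix} n\\ k\end{matrix}\right\rceil\!\!\right\rceil_{s}=\sum_{j=k}^{n}\left[\!\left[\begin{matrix}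 n\\ j\end{matrix}\right]\!\right]_{s}\left\{\!\left\{\begin{matrix} j\\ k\end{matrix}\right\}\!\right\}_{s},$$ and are $0$ for $n<k$. *)

(* Defs.v *)
From mathcomp Require Import all_boot all_fingroup.

Set Implicit Arguments.
Unset Strict Implicit.
Unset Printing Implicit Defensive.

(* The ground set [n] = {1, ..., n} is represented by 'I_n = {0, ..., n-1};
   the shift by 1 is increasing, hence preserves block minima. *)
Definition bl (n : nat) (P : {set {set 'I_n}}) : {set 'I_n} :=
  [set i | [exists b in P, (i \in b) && [forall j in b, i <= j]]].

(* A partition of [n] into non-empty cyclically ordered blocks is given by the
   permutation sending each element to its successor in its block; the
   underlying set partition is then the set of its cycles, fixed points
   included. *)
Definition stirling1 (s n k : nat) : nat :=
  #|[set t : s.-tuple {perm 'I_n} |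
      [forall i, #|porbits (tnth t i)| == k] &&
      [forall i, forall j,
         bl (porbits (tnth t i)) == bl (porbits (tnth t j))]]|.

Definition stirling2 (s n k : nat) : nat :=
  #|[set t : s.-tuple {set {set 'I_n}} |
      [forall i, partition (tnth t i) [set: 'I_n] && (#|tnth t i| == k)] &&
      [forall i, forall j, bl (tnth t i) == bl (tnth t j)]]|.

Definition lah (s n k : nat) : nat :=
  \sum_(k <= j < n.+1) stirling1 s n j * stirling2 s j k.

(* Main.v *)
Require Import Defs.
From mathcomp Require Import all_boot all_fingroup.

(** Fix a set [M] of prescribed block minima inside ['I_n].  Build a partition,
or a permutation, by adding the elements [0, 1, ..., n-1] in increasing order:
an element of [M] opens a new block, and any other element [i] joins an
existing one.  In a set partition, [i] chooses one of the blocks already open,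
that is one of the [m \in M] with [m < i]; in a permutation it is inserted into
a cycle just before one of the [i] elements already present.  Hence the number
of objects whose set of minima is [M] is a product over [i \notin M], of
[#|[set m in M | m < i]|] for partitions ([card_partitions_minima]) and of [i]
for permutations ([card_perms_minima]).  No case distinction is needed when
[0 \notin M]: the factor at [i = 0] is then [0].

An [s]-tuple with a common set of minima contributes the [s]-th power of this
count, so both kinds of higher-level Stirling numbers are sums, over the sets
[M] of [k] elements, of a product of weights [w i c] over [i \notin M], where
[c] is the number of minima below [i]: the weight is [i ^ s] for the first kind
and [c ^ s] for the second ([stirling1E], [stirling2E]).  Deciding whether the
last element of ['I_n.+1] lies in [M] gives one recurrence for all such sums
([minima_sum_recr]).

The Lah recurrence follows formally: in [\sum_j stirling1 s n.+1 j *
stirling2 s j k.+1], expand the first factor, shift the index in the part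
coming from [stirling1 s n (j - 1)], and expand the second factor there. *)

Set Implicit Arguments.
Unset Strict Implicit.
Unset Printing Implicit Defensive.

(** * Block minima *)

Lemma mem_bl (n : nat) (P : {set {set 'I_n}}) (i : 'I_n) :
  partition P [set: 'I_n] ->
  (i \in bl P) = [forall j in pblock P i, i <= j].
Proof.
case/and3P=> /eqP covP trivP _; rewrite inE.
have iP : i \in cover P by rewrite covP inE.
apply/exists_inP/idP => [[b bP /andP[ib min_i]] | min_i].
  by rewrite (def_pblock trivP bP ib).
by exists (pblock P i); rewrite ?pblock_mem // mem_pblock iP.
Qed.

(** Mapping a minimum to its block is a bijection from [bl P] to [P].  This is
what turns the condition on the number of blocks into one on [bl P] alone. *)
Lemma card_bl (n : nat) (P : {set {set 'I_n}}) :
  partition P [set: 'I_n] -> #|bl P| = #|P|.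
Proof.
move=> parP; have /and3P[/eqP covP trivP P0] := parP.
have inP (i : 'I_n) : i \in cover P by rewrite covP inE.
rewrite -(@card_in_imset _ _ (pblock P)).
  congr #|pred_of_set _|; apply/setP=> b; apply/imsetP/idP => [[i _ ->] | bP].
    exact: pblock_mem.
  have /set0Pn[x xb] : b != set0 by apply: contraNneq P0 => <-.
  case: (@arg_minnP _ x (mem b) (@nat_of_ord n) xb) => i ib min_i.
  exists i; last by rewrite (def_pblock trivP bP ib).
  rewrite mem_bl // (def_pblock trivP bP ib).
  by apply/forall_inP.
move=> i j; rewrite !mem_bl // => /forall_inP min_i /forall_inP min_j eq_ij.
apply/val_inj/anti_leq/andP; split.
  by apply: min_i; rewrite eq_ij mem_pblock.
by apply: min_j; rewrite -eq_ij mem_pblock.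
Qed.

Lemma partition_porbits (T : finType) (p : {perm T}) :
  partition (porbits p) [set: T].
Proof.
suff -> : porbits p = preim_partition (porbit p) [set: T]
  by exact: preim_partitionP.
have porbitE x : porbit p x = [set y in [set: T] | porbit p x == porbit p y].
  by apply/setP=> y; rewrite !inE eq_porbit_mem porbit_sym.
apply/setP=> b; apply/imsetP/imsetP=> -[x _ ->]; exists x;
  rewrite ?inE //; exact: porbitE.
Qed.

Lemma mem_bl_porbits (n : nat) (p : {perm 'I_n}) (i : 'I_n) :
  (i \in bl (porbits p)) = [forall j in porbit p i, i <= j].
Proof.
rewrite mem_bl ?partition_porbits //.
have /and3P[_ trivP _] := partition_porbits p.
by rewrite (def_pblock trivP (imset_f _ _) (porbit_id p i)).
Qed.

(** * Partitions with prescribed block minima *)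

Lemma mem_pblock_preim (T : finType) (rT : eqType) (f : T -> rT) (x y : T) :
  (y \in pblock (preim_partition f setT) x) = (f x == f y).
Proof.
apply: pblock_equivalence_partition; rewrite ?inE //.
by move=> u v w _ _ _ /=; split=> [|/eqP->].
Qed.

Section PartitionsWithMinima.

Variables (n : nat) (M : {set 'I_n}).

(** A partition is encoded by the function sending each element to the minimum
of its block; when the minima are [M], these functions form a product. *)
Definition min_choices (i : 'I_n) : pred 'I_n :=
  [pred m | if i \in M then m == i else (m \in M) && (m < i)].

Lemma min_choicesP (f : {ffun 'I_n -> 'I_n}) :
  f \in family min_choices ->
  [/\ forall i, f i <= i, forall i, f i \in M & forall i, i \in M -> f i = i].
Proof.
move/familyP=> famf.
split=> [i | i | i iM]; move: (famf i); rewrite inE /=.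
- by case: ifP => _; [move/eqP-> | case/andP=> _ /ltnW].
- by case: ifP => [iM /eqP-> | _ /andP[]].
- by rewrite iM => /eqP.
Qed.

(** The code can be read off the partition: [f i] is an element of the block of
[i] and is a lower bound of that block. *)
Lemma preim_partition_minima_inj :
  {in family min_choices &,
    injective (fun f : {ffun 'I_n -> 'I_n} => preim_partition f setT)}.
Proof.
suff le_fg (f g : {ffun 'I_n -> 'I_n}) i :
    f \in family min_choices -> g \in family min_choices ->
    preim_partition f setT = preim_partition g setT -> g i <= f i.
  move=> f g Ff Fg eq_fg; apply/ffunP=> i.
  by apply/val_inj/anti_leq; rewrite !le_fg.
move=> /min_choicesP[_ f_M f_id] /min_choicesP[g_le _ _] eq_fg.
have : f i \in pblock (preim_partition f setT) i.
  by rewrite mem_pblock_preim (f_id (f i)).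
by rewrite eq_fg mem_pblock_preim => /eqP->.
Qed.

Lemma bl_preim_partition (f : {ffun 'I_n -> 'I_n}) :
  f \in family min_choices -> bl (preim_partition f setT) = M.
Proof.
move=> Ff; have [f_le f_M f_id] := min_choicesP Ff.
apply/setP=> i; rewrite mem_bl ?preim_partitionP //.
apply/forall_inP/idP=> [min_i | iM j].
  suff <- : f i = i by [].
  apply/val_inj/anti_leq; rewrite f_le min_i //.
  by rewrite mem_pblock_preim (f_id (f i)).
by rewrite mem_pblock_preim f_id // => /eqP->.
Qed.

Lemma preim_partition_minima_onto (P : {set {set 'I_n}}) :
  partition P setT -> bl P = M ->
  exists2 f : {ffun 'I_n -> 'I_n},
    f \in family min_choices & P = preim_partition f setT.
Proof.
move=> parP blP; have /and3P[/eqP covP trivP _] := parP.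
have inP i : i \in pblock P i by rewrite mem_pblock covP inE.
pose f := [ffun i => [arg min_(m < i in pblock P i) (m : nat)]].
have fP i : f i \in pblock P i /\ forall j, j \in pblock P i -> f i <= j.
  by rewrite ffunE; case: arg_minnP.
have pb_f i : pblock P (f i) = pblock P i.
  by apply: same_pblock trivP _; case: (fP i).
have f_M i : f i \in M.
  rewrite -blP mem_bl //; apply/forall_inP=> j.
  by rewrite pb_f; case: (fP i) => _; apply.
exists f.
  apply/familyP=> i; rewrite inE /= f_M.
  have fi_le : f i <= i by case: (fP i) => _; apply.
  case: ifP => [iM | /negP iM].
    apply/eqP/val_inj/anti_leq; rewrite fi_le.
    move: iM; rewrite -blP mem_bl // => /forall_inP; apply.
    by case: (fP i).
  rewrite ltn_neqAle fi_le andbT.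
  by apply/negP=> /eqP/val_inj eq_i; apply: iM; rewrite -eq_i.
rewrite -[LHS](equivalence_partition_pblock parP).
apply: eq_imset => i; apply/setP=> j; rewrite !inE /=.
rewrite -eq_pblock ?covP ?inE //; apply/eqP/eqP=> [eq_ij | eq_f].
  have [fi min_fi] := fP i; have [fj min_fj] := fP j.
  by apply/val_inj/anti_leq; rewrite min_fi ?eq_ij // min_fj -?eq_ij.
by rewrite -pb_f eq_f pb_f.
Qed.

Lemma card_partitions_minima :
  #|[set P | partition P [set: 'I_n] && (bl P == M)]| =
  \prod_(i | i \notin M) #|[set m in M | m < i]|.
Proof.
have <- : [set preim_partition f setT | f : {ffun 'I_n -> 'I_n} in
             family min_choices] =
          [set P | partition P [set: 'I_n] && (bl P == M)].
  apply/setP=> P; rewrite inE; apply/imsetP/andP.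
    case=> f Ff ->; split; first exact: preim_partitionP.
    by rewrite bl_preim_partition.
  by case=> parP /eqP blP; apply: preim_partition_minima_onto.
rewrite (card_in_imset preim_partition_minima_inj) card_family foldrE big_image.
rewrite [RHS]big_mkcond; apply: eq_bigr => i _ /=.
case: ifPn => [iM | /negbNE iM].
  by apply: eq_card => m; rewrite !inE (negbTE iM).
by rewrite -(card1 i); apply: eq_card => m; rewrite !inE iM.
Qed.

End PartitionsWithMinima.

(** * Permutations with prescribed cycle minima *)

Lemma porbit_sub (T : finType) (p : {perm T}) (A : {set T}) (x : T) :
  x \in A -> {in A, forall y, p y \in A} -> porbit p x \subset A.
Proof.
move=> xA pA; apply/subsetP=> _ /porbitP[k ->].
by elim: k => [|k IHk]; rewrite ?expg0 ?perm1 // expgSr permM pA.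
Qed.

Lemma mem_porbit_step (T : finType) (p : {perm T}) (x y : T) :
  (p y \in porbit p x) = (y \in porbit p x).
Proof.
have eq_y : porbit p (p y) = porbit p y := porbit_perm p 1 y.
by rewrite -!eq_porbit_mem eq_y.
Qed.

Section PermutationsWithMinima.

Variable n : nat.

Lemma fixed_bl (p : {perm 'I_n}) (x : 'I_n) : p x = x -> x \in bl (porbits p).
Proof.
move=> px; rewrite mem_bl_porbits; apply/forall_inP=> j.
have : porbit p x \subset [set x].
  by apply: porbit_sub (set11 x) _ => _ /set1P->; rewrite px set11.
by move/subsetP=> sub /sub/set1P->.
Qed.

(** [p * tperm x g] is [p] with [x] inserted just before [g] in the cycle of
[g].  Since [g < x], the element [x] is not minimal in its new cycle, and its
arrival leaves the minimum of that cycle unchanged. *)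
Lemma bl_insert (p : {perm 'I_n}) (x g : 'I_n) :
  p x = x -> g < x ->
  bl (porbits (p * tperm x g)) = bl (porbits p) :\ x.
Proof.
move=> px lt_gx; set q := (p * tperm x g)%g.
have qx : q x = g by rewrite permM px tpermL.
have q_g y : p y = g -> q y = x by move=> py; rewrite permM py tpermR.
have p_x y : (p y == x) = (y == x) by rewrite -[in LHS]px (inj_eq perm_inj).
have q_id y : y != x -> p y != g -> q y = p y.
  by move=> yx pyg; rewrite permM tpermD // eq_sym ?p_x.
apply/setP=> i; rewrite in_setD1 !mem_bl_porbits.
have [-> | ix] /= := eqVneq i x.
  apply/negP=> /forall_inP/(_ g).
  by rewrite -{1}qx mem_porbit_step porbit_id leqNgt lt_gx => /(_ isT).
have sub_pq : porbit p i \subset porbit q i.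
  apply: porbit_sub (porbit_id q i) _ => y yq.
  have [yx | yx] := eqVneq y x; first by rewrite yx px -yx.
  have [py | pyg] := eqVneq (p y) g.
    by rewrite py -qx mem_porbit_step -(q_g y py) mem_porbit_step.
  by rewrite -q_id // mem_porbit_step.
(* The cycle of i, enlarged by x exactly when it contains g. *)
pose A := [set y | if y == x then g \in porbit p i else y \in porbit p i].
have sub_qA : porbit q i \subset A.
  apply: porbit_sub; first by rewrite inE (negbTE ix) porbit_id.
  move=> y; rewrite !inE; have [-> | yx] := eqVneq y x.
    by rewrite qx; case: eqP.
  have [py yp | pyg yp] := eqVneq (p y) g.
    by rewrite q_g // eqxx -py mem_porbit_step.
  by rewrite q_id // p_x (negbTE yx) mem_porbit_step.
apply/forall_inP/forall_inP=> min_i j jp; first exact/min_i/(subsetP sub_pq).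
move: (subsetP sub_qA j jp); rewrite inE; case: eqP => [-> g_i | _ jp'].
  exact: leq_trans (min_i g g_i) (ltnW lt_gx).
exact: min_i.
Qed.

(** The permutations of the first [m] elements, kept inside ['I_n]: all later
elements are fixed points, so they are all block minima. *)
Definition perms_below (m : nat) (M : {set 'I_n}) : {set {perm 'I_n}} :=
  [set p : {perm 'I_n} |
    perm_on [set i : 'I_n | i < m] p && (bl (porbits p) == M)].

Lemma perm_onSr (m : nat) (p : {perm 'I_n}) (x : 'I_n) :
  x = m :> nat ->
  perm_on [set i : 'I_n | i < m] p =
  perm_on [set i : 'I_n | i < m.+1] p && (p x == x).
Proof.
move=> xm; apply/idP/andP=> [p_on | [p_on /eqP px]].
  split; last by rewrite (out_perm p_on) // inE xm ltnn.
  apply: subset_trans p_on _; apply/subsetP=> i; rewrite !inE; exact: leqW.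
apply/subsetP=> i pi; move: (subsetP p_on i pi); rewrite !inE ltnS leq_eqVlt.
case/orP=> // /eqP im; case/eqP: pi.
by have -> : i = x by apply/val_inj; rewrite /= im xm.
Qed.

(** Induction on [m].  A permutation whose cycle minima include the element
number [m] must fix it, as its image is at least [m] and no larger element
moves; otherwise that element is removed from its cycle, and its position is
remembered by its former image, one of the [m] smaller elements. *)
Lemma card_perms_below (m : nat) (M : {set 'I_n}) :
  m <= n -> (forall i : 'I_n, m <= i -> i \in M) ->
  #|perms_below m M| = \prod_(i | i \notin M) i.
Proof.
elim: m M => [|m IHm] M => [_ | lt_mn] M_above.
  have -> : M = setT by apply/setP=> i; rewrite inE M_above.
  rewrite big_pred0 => [|i]; last by rewrite inE.
  apply/eqP/cards1P; exists 1%g; apply/setP=> p; rewrite !inE.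
  apply/andP/eqP=> [[p_on _] | ->].
    by apply/permP=> i; rewrite perm1 (out_perm p_on) // inE.
  split; first exact: perm_on1.
  by apply/eqP/setP=> i; rewrite in_setT fixed_bl ?perm1.
pose x := Ordinal lt_mn.
have bl_le (p : {perm 'I_n}) i : i \in bl (porbits p) -> i <= p i.
  rewrite mem_bl_porbits => /forall_inP; apply.
  by rewrite mem_porbit_step porbit_id.
have [xM | xM] := boolP (x \in M).
  rewrite -IHm ?(ltnW lt_mn) // => [|i].
    apply: eq_card => p; rewrite !inE (@perm_onSr m p x) // -andbA.
    apply: andb_id2l => p_on; rewrite andb_idl // => /eqP blp.
    apply/eqP/val_inj/anti_leq; rewrite bl_le ?blp // andbT.
    by have := perm_closed x p_on; rewrite !inE ltnS leqnn => ->.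
  rewrite leq_eqVlt => /orP[/eqP xi | /M_above //].
  by have <- : x = i by apply/val_inj.
pose ins (gp : 'I_n * {perm 'I_n}) := (gp.2 * tperm x gp.1)%g.
pose D := setX [set g : 'I_n | g < m] (perms_below m (x |: M)).
have D_P g p : (g, p) \in D ->
    [/\ g < x, perm_on [set i : 'I_n | i < m.+1] p, p x = x &
        bl (porbits p) = x |: M].
  rewrite !inE /= => /and3P[g_lt]; rewrite (@perm_onSr m p x) //.
  by case/andP=> p_on /eqP px /eqP blp.
have ins_x g p : (g, p) \in D -> ins (g, p) x = g.
  by case/D_P=> _ _ px _; rewrite permM /= px tpermL.
have <- : ins @: D = perms_below m.+1 M.
  apply/setP=> q; apply/imsetP/idP=> [[[g p] Dgp ->] | ].
    have [lt_gx p_on px blp] := D_P _ _ Dgp.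
    rewrite inE bl_insert // blp setU1K // eqxx andbT.
    apply: perm_onM p_on _; apply: subset_trans (tperm_on _ _) _.
    by apply/subsetP=> i; rewrite !inE => /orP[] /eqP->; rewrite // ltnW.
  rewrite inE => /andP[q_on /eqP blq].
  have qx_le : q x <= x by have := perm_closed x q_on; rewrite !inE ltnS leqnn.
  have qx_neq : q x != x.
    by apply: contra xM => /eqP qx; rewrite -blq fixed_bl.
  have lt_qx : q x < x by rewrite ltn_neqAle qx_le andbT.
  pose p := (q * tperm x (q x))%g.
  have qE : q = (p * tperm x (q x))%g by rewrite -mulgA tperm2 mulg1.
  have px : p x = x by rewrite permM tpermR.
  exists (q x, p) => //.
  rewrite !inE lt_qx /= (@perm_onSr m p x) // px eqxx andbT.
  apply/andP; split.
    apply: perm_onM q_on _; apply: subset_trans (tperm_on _ _) _.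
    by apply/subsetP=> i; rewrite !inE => /orP[] /eqP->; rewrite // ltnW.
  have -> : M = bl (porbits p) :\ x by rewrite -(bl_insert px lt_qx) -qE.
  by rewrite setD1K // fixed_bl.
rewrite card_in_imset => [|[g p] [h q] Dgp Dhq eq_ins]; last first.
  have eq_gh : g = h by rewrite -(ins_x _ _ Dgp) eq_ins ins_x.
  by move: eq_ins; rewrite eq_gh => /mulIg /= ->.
rewrite cardsX IHm ?(ltnW lt_mn) // => [|i]; last first.
  rewrite in_setU1 leq_eqVlt => /orP[/eqP xi | /M_above ->]; last exact: orbT.
  by rewrite -val_eqE /= xi eqxx.
rewrite [RHS](bigD1 x) //=; congr (_ * _).
  rewrite -sum1_card; under eq_bigl do rewrite inE.
  by rewrite (big_ord_narrow (ltnW lt_mn)) sum1_card card_ord.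
by apply: eq_bigl => i; rewrite !inE negb_or andbC.
Qed.

Lemma card_perms_minima (M : {set 'I_n}) :
  #|[set p : {perm 'I_n} | bl (porbits p) == M]| = \prod_(i | i \notin M) i.
Proof.
rewrite -(@card_perms_below n) // => [|i]; last by rewrite leqNgt ltn_ord.
apply: eq_card => p; rewrite !inE andb_idl // => _.
by apply/subsetP=> i _; rewrite inE.
Qed.

End PermutationsWithMinima.

(** * Tuples with a common invariant *)

Lemma card_tuples_in (T : finType) (s : nat) (A : {set T}) :
  #|[set t : s.-tuple T | [forall i, tnth t i \in A]]| = #|A| ^ s.
Proof.
rewrite -[in RHS](card_ord s) -card_ffun_on.
rewrite -(card_imset _ (can_inj (@tuple_of_finfunK T s))).
apply: eq_card => t; rewrite inE; apply/forallP/imsetP=> [t_A | [f f_A ->] i].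
  exists (finfun_of_tuple t); last by rewrite finfun_of_tupleK.
  by apply/ffun_onP=> i; rewrite ffunE t_A.
by rewrite tnth_mktuple (ffun_onP f_A).
Qed.

(** Sort the tuples by the common value [u] of [f].  A first entry is needed to
name that value, hence [0 < s]. *)
Lemma card_tuples_common (T U : finType) (s : nat) (A : pred T) (B : pred U)
    (f : T -> U) (c : U -> nat) :
  0 < s ->
  {in A, forall x, B (f x)} ->
  (forall u, B u -> #|[set x | A x && (f x == u)]| = c u) ->
  #|[set t : s.-tuple T | [forall i, A (tnth t i)] &&
       [forall i, forall j, f (tnth t i) == f (tnth t j)]]| =
  \sum_(u | B u) c u ^ s.
Proof.
case: s => // s _ BfA cardA; rewrite -sum1_card.
pose f0 (t : s.+1.-tuple T) := f (tnth t ord0).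
rewrite (@partition_big _ _ _ _ _ _ _ f0 B) /=; last first.
  by move=> t; rewrite inE => /andP[/forallP At _]; apply: BfA; apply: At.
apply: eq_bigr => u Bu; rewrite -cardA // -card_tuples_in -sum1_card.
apply: eq_bigl => t; rewrite !inE; apply/andP/forallP.
  case=> /andP[/forallP At /forallP eq_f] /eqP <- i.
  by rewrite inE At (forallP (eq_f i)).
move=> At; have {}At i : A (tnth t i) /\ f (tnth t i) = u.
  by have := At i; rewrite inE => /andP[-> /eqP].
split; last by rewrite /f0 (proj2 (At _)).
apply/andP; split; apply/forallP=> i; first by case: (At i).
by apply/forallP=> j; rewrite !(proj2 (At _)).
Qed.

(** * Sums over the set of block minima *)

Lemma prod_expn (I : finType) (P : pred I) (F : I -> nat) (s : nat) :
  (\prod_(i | P i) F i) ^ s = \prod_(i | P i) F i ^ s.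
Proof. by apply: (big_morph (expn^~ s)) => [a b|]; rewrite ?expnMn ?exp1n. Qed.

(** The common form of the two kinds of Stirling numbers: the weight [w i c] of
an element [i] outside [M] may depend on [i] and on the number [c] of minima
preceding it. *)
Definition minima_sum (w : nat -> nat -> nat) (n k : nat) : nat :=
  \sum_(M : {set 'I_n} | #|M| == k)
    \prod_(i | i \notin M) w i #|[set m in M | m < i]|.

Lemma stirling1E (s n k : nat) :
  0 < s -> stirling1 s n k = minima_sum (fun i _ => i ^ s) n k.
Proof.
move=> s_gt0; pose c (M : {set 'I_n}) := \prod_(i | i \notin M) (i : nat).
rewrite /stirling1.
rewrite (@card_tuples_common {perm 'I_n} {set 'I_n} s
  (fun p => #|porbits p| == k) (fun M => #|M| == k)
  (fun p => bl (porbits p)) c) //.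
- by apply: eq_bigr => M _; rewrite /c prod_expn.
- by move=> p; rewrite -topredE /= card_bl ?partition_porbits.
move=> M /eqP cardM; rewrite /c -card_perms_minima.
apply: eq_card => p; rewrite !inE andb_idl // => /eqP blp.
by rewrite -card_bl ?partition_porbits // blp cardM.
Qed.

Lemma stirling2E (s n k : nat) :
  0 < s -> stirling2 s n k = minima_sum (fun _ c => c ^ s) n k.
Proof.
move=> s_gt0.
pose c (M : {set 'I_n}) := \prod_(i | i \notin M) #|[set m in M | m < i]|.
rewrite /stirling2.
rewrite (@card_tuples_common {set {set 'I_n}} {set 'I_n} s
  (fun P => partition P setT && (#|P| == k)) (fun M => #|M| == k)
  (@bl n) c) //.
- by apply: eq_bigr => M _; rewrite /c prod_expn.
- by move=> P; rewrite -topredE /= => /andP[parP /eqP <-]; rewrite card_bl.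
move=> M /eqP cardM; rewrite /c -card_partitions_minima.
apply: eq_card => P; rewrite !inE -andbA; apply: andb_id2l => parP.
by rewrite andb_idl // => /eqP blP; rewrite -card_bl // blP cardM.
Qed.

Section SplitLast.

Variable n : nat.

Let wid : 'I_n -> 'I_n.+1 := widen_ord (leqnSn n).

Lemma widen_ord_max (i : 'I_n) : (wid i == ord_max) = false.
Proof. by apply/negbTE; rewrite neq_ltn /= ltn_ord. Qed.

(** A subset of ['I_n.+1] is its trace on ['I_n] together with one bit. *)
Lemma sum_sets_recr (G : {set 'I_n} -> bool -> nat) :
  \sum_(M : {set 'I_n.+1}) G (wid @^-1: M) (ord_max \in M) =
  \sum_(A : {set 'I_n}) (G A true + G A false).
Proof.
have wid_inj : injective wid by move=> i j /(congr1 val) /= /val_inj.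
pose join (A : {set 'I_n}) (b : bool) :=
  if b then ord_max |: wid @: A else wid @: A.
have max_join A b : (ord_max \in join A b) = b.
  case: b; first by rewrite setU11.
  by apply/imsetP=> -[i _ /eqP]; rewrite eq_sym widen_ord_max.
have widK A b : wid @^-1: join A b = A.
  by case: b; apply/setP=> i; rewrite !inE ?widen_ord_max mem_imset.
have joinK (M : {set 'I_n.+1}) : join (wid @^-1: M) (ord_max \in M) = M.
  apply/setP=> i; have [-> | i_max] := eqVneq i ord_max.
    by rewrite max_join.
  have lt_in : i < n.
    by move: i_max; rewrite -val_eqE /= ltn_neqAle -ltnS ltn_ord andbT.
  have -> : i = wid (Ordinal lt_in) by apply/val_inj.
  have widE (B : {set 'I_n.+1}) j : (wid j \in B) = (j \in wid @^-1: B).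
    by rewrite inE.
  by rewrite widE widK -widE.
under [RHS]eq_bigr do rewrite -big_bool.
rewrite pair_big (reindex_onto
  (fun M : {set 'I_n.+1} => (wid @^-1: M, ord_max \in M))
  (fun Ab => join Ab.1 Ab.2)) /=.
  by apply: eq_bigl => M; rewrite joinK eqxx.
by case=> A b _ /=; rewrite widK max_join.
Qed.

Lemma card_recr (M : {set 'I_n.+1}) :
  #|M| = #|wid @^-1: M| + (ord_max \in M).
Proof.
rewrite -!sum1_card big_mkcond big_ord_recr [X in _ = X + _]big_mkcond /=.
congr (_ + _).
by apply: eq_bigr => i _; rewrite inE.
Qed.

(** The last element precedes no other, so it changes no factor but its own;
all the elements of the trace precede it, which makes that factor
[w n #|wid @^-1: M|]. *)
Lemma minima_prod_recr (w : nat -> nat -> nat) (M : {set 'I_n.+1}) :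
  \prod_(i | i \notin M) w i #|[set m in M | m < i]| =
  (\prod_(i | i \notin wid @^-1: M) w i #|[set m in wid @^-1: M | m < i]|) *
  (if ord_max \in M then 1 else w n #|wid @^-1: M|).
Proof.
have cardE (i : nat) : i <= n ->
    #|[set m in M | m < i]| = #|[set m in wid @^-1: M | m < i]|.
  move=> le_in; rewrite card_recr !inE /= ltnNge le_in andbF addn0.
  by apply: eq_card => m; rewrite !inE.
rewrite !(big_mkcond (fun i => i \notin _)) big_ord_recr /= if_neg.
congr (_ * _).
  by apply: eq_bigr => i _; rewrite cardE 1?ltnW // [i \in _]inE.
rewrite cardE //; case: ifP => // _; congr (w _ _).
by apply: eq_card => m; rewrite !inE ltn_ord andbT.
Qed.

Lemma minima_sum_recr (w : nat -> nat -> nat) (k : nat) :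
  minima_sum w n.+1 k.+1 =
  minima_sum w n k + w n k.+1 * minima_sum w n k.+1.
Proof.
pose p (A : {set 'I_n}) := \prod_(i | i \notin A) w i #|[set m in A | m < i]|.
rewrite /minima_sum big_mkcond.
under eq_bigr do rewrite card_recr minima_prod_recr -/(p _).
rewrite (sum_sets_recr (fun A b => if #|A| + b == k.+1
  then p A * (if b then 1 else w n #|A|) else 0)) big_split /=.
rewrite -!big_mkcond big_distrr /=; congr (_ + _).
  by apply: eq_big => [A | A _]; rewrite ?addn1 ?eqSS // muln1.
by apply: eq_big => [A | A /eqP]; rewrite addn0 // mulnC => ->.
Qed.

End SplitLast.

(** Only [M = set0] contributes, and then the element [0] has no block to
join. *)
Lemma minima_sum_n0 (w : nat -> nat -> nat) (n : nat) :
  w 0 0 = 0 -> minima_sum w n.+1 0 = 0.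
Proof.
move=> w0; rewrite /minima_sum big1 // => M /eqP/cards0_eq->.
rewrite (bigD1 ord0) ?inE //= [X in w _ X](_ : _ = 0) ?w0 //.
by apply: eq_card0 => m; rewrite !inE.
Qed.

Lemma minima_sum_gt (w : nat -> nat -> nat) (n k : nat) :
  n < k -> minima_sum w n k = 0.
Proof.
move=> lt_nk; rewrite /minima_sum big_pred0 // => M.
have le_Mn : #|M| <= n by rewrite -[leqRHS](card_ord n) max_card.
by rewrite ltn_eqF // (leq_ltn_trans le_Mn).
Qed.

Lemma minima_sum_nn (w : nat -> nat -> nat) (n : nat) : minima_sum w n n = 1.
Proof.
rewrite /minima_sum (big_pred1 setT) => [|M] /=.
  by rewrite big_pred0 // => i; rewrite inE.
by rewrite eqEcard subsetT cardsT card_ord eqn_leq -[X in _ <= X](card_ord n)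
  max_card.
Qed.

(** * The Lah recurrence *)

(** Starting the sum at [0] makes the index shift in the recurrence uniform. *)
Lemma lah_full (s n k : nat) : 0 < s ->
  lah s n k = \sum_(j < n.+1) stirling1 s n j * stirling2 s j k.
Proof.
move=> s_gt0; rewrite /lah big_geq_mkord big_mkcond /=.
apply: eq_bigr => j _; case: leqP => // lt_jk.
by rewrite stirling2E // minima_sum_gt // muln0.
Qed.

Lemma lah_rec (s n k : nat) : 0 < s ->
  lah s n.+1 k.+1 = lah s n k + (n ^ s + k.+1 ^ s) * lah s n k.+1.
Proof.
move=> s_gt0; rewrite !lah_full //.
have s1_rec j : stirling1 s n.+1 j.+1 =
    stirling1 s n j + n ^ s * stirling1 s n j.+1.
  by rewrite !stirling1E // minima_sum_recr.
have s2_rec j : stirling2 s j.+1 k.+1 =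
    stirling2 s j k + k.+1 ^ s * stirling2 s j k.+1.
  by rewrite !stirling2E // minima_sum_recr.
have s2_0 : stirling2 s 0 k.+1 = 0 by rewrite stirling2E // minima_sum_gt.
have s1_gt : stirling1 s n n.+1 = 0 by rewrite stirling1E // minima_sum_gt.
rewrite big_ord_recl s2_0 muln0 add0n.
under eq_bigr do rewrite lift0 s1_rec mulnDl.
rewrite big_split /= [X in _ + X = _](_ : _ =
    n ^ s * \sum_(j < n.+1) stirling1 s n j * stirling2 s j k.+1); last first.
  rewrite big_ord_recr /= s1_gt muln0 addn0.
  rewrite [in RHS]big_ord_recl s2_0 muln0 add0n big_distrr /=.
  by apply: eq_bigr => j _; rewrite mulnA.
under eq_bigr do rewrite s2_rec mulnDr.
rewrite big_split /= mulnDl -!addnA; congr (_ + _).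
rewrite addnC; congr (_ + _).
by rewrite big_distrr; apply: eq_bigr => j _; rewrite mulnCA.
Qed.

Theorem theorem3p2 (s : nat) (hs : 1 <= s) :
  (forall n k : nat, 1 <= n -> 1 <= k ->
     lah s n k =
       lah s (n - 1) (k - 1) + ((n - 1) ^ s + k ^ s) * lah s (n - 1) k) /\
  (forall n : nat, lah s n n = 1) /\
  (forall n : nat, 0 < n -> lah s n 0 = 0 /\ lah s 0 n = 0).
Proof.
split=> [[|n] [|k] // _ _|]; first by rewrite !subn1 lah_rec.
split=> [n | [|n] // _].
  by rewrite /lah big_nat1 stirling1E // stirling2E // !minima_sum_nn.
split; last by rewrite /lah big_geq.
rewrite lah_full // big1 // => -[[|j] lt_j] _ /=.
  by rewrite stirling1E // minima_sum_n0 // exp0n.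
by rewrite stirling2E // minima_sum_n0 ?muln0 // exp0n.
Qed.
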